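(* Let $n\geq 1$ and let $\overline{H_1},\overline{H_2}$ be irreducible subgroups of $PSL(n,\mathbb{C})$, with preimages $H_i=\pi_n^{-1}(\overline{H_i})\le SL(n,\mathbb{C})$. Then $Z_{PSL(n,\mathbb{C})}(\overline{H_1})$ and $Z_{PSL(n,\mathbb{C})}(\overline{H_2})$ are conjugate in $PSL(n,\mathbb{C})$ if and only if the associated alternate modules $(Z_{PSL(n,\mathbb{C})}(\overline{H_1}),\phi_{H_1})$ and $(Z_{PSL(n,\mathbb{C})}(\overline{H_2}),\phi_{H_2})$ are isometric.
   Context: Let $\xi=e^{2\pi i/n}$ and $\pi_n:SL(n,\mathbb{C})\to PSL(n,\mathbb{C})=SL(n,\mathbb{C})/\langle\xi I_n\rangle$. A subgroup of $SL(n,\mathbb{C})$ is irreducible if no nonzero proper subspace of $\mathbb{C}^n$ is invariant; a subgroup of $PSL(n,\mathbb{C})$ is irreducible if its preimage is. For $H$ irreducible in $SL(n,\mathbb{C})$, let $Z_n(H)=Z_{PSL(n,\mathbb{C})}(\pi_n(H))$ (a finite abelian group) and $U_n(H)=\pi_n^{-1}(Z_n(H))$. The associated alternate module is $(Z_n(H),\phi_H)$ where, for $a,b\in Z_n(H)$ with lifts $\hat a,\hat b\in U_n(H)$, $\hat a\hat b\hat a^{-1}\hat b^{-1}=\xi^kI_n$ and $\phi_H(a,b)=k/n\in\mathbb{Q}/\mathbb{Z}$ (independent of lifts). An alternate module is a finite abelian group $A$ with a biadditive $\phi:A\times A\to\mathbb{Q}/\mathbb{Z}$ with $\phi(a,a)=0$;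 an isometry is a form-preserving group isomorphism. *)

(* Defs.v *)
From HB Require Import structures.
From mathcomp Require Import all_boot all_order all_algebra.
Set Implicit Arguments. Unset Strict Implicit. Unset Printing Implicit Defensive.
Import Order.TTheory GRing.Theory Num.Theory.
Local Open Scope ring_scope.

(* C : an algebraically closed field of characteristic 0 with conjugation
   (numClosedFieldType); the complex numbers are an instance.
   xi : a primitive n-th root of unity (e^{2 pi i/n}).
   Elements of PSL(n,C) are represented by their lifts in SL(n,C);
   pi_n a = pi_n b  iff  a = xi^k b for some k. *)

Definition SLn (C : numClosedFieldType) (n : nat) (g : 'M[C]_n) : Prop :=
  \det g = 1.

Definition pi_eq (C : numClosedFieldType) (n : nat) (xi : C) (a b : 'M[C]_n) : Prop :=
  exists k : nat, a = (xi ^+ k) *: b.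

Definition subgroup_SL (C : numClosedFieldType) (n : nat) (H : 'M[C]_n -> Prop) : Prop :=
  [/\ H 1%:M,
      (forall a b, H a -> H b -> H (a *m b)),
      (forall a, H a -> H (invmx a)) &
      (forall a, H a -> SLn a)].

Definition pi_saturated (C : numClosedFieldType) (n : nat) (xi : C) (H : 'M[C]_n -> Prop) : Prop :=
  forall a b, H a -> pi_eq xi b a -> H b.

(* irreducible: no nonzero proper subspace of C^n (column vectors) is invariant.
   A subspace W is represented by a matrix U whose rows span W (as vectors);
   h W <= W  reads  U *m h^T <= U. *)
Definition irreducible_SL (C : numClosedFieldType) (n : nat) (H : 'M[C]_n -> Prop) : Prop :=
  forall U : 'M[C]_n,
    (forall h, H h -> (U *m h^T <= U)%MS) -> \rank U = 0%N \/ \rank U = n.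

(* U_n(H) = pi_n^{-1}(Z_{PSL}(pi_n H)) *)
Definition Ulift (C : numClosedFieldType) (n : nat) (xi : C) (H : 'M[C]_n -> Prop)
  (g : 'M[C]_n) : Prop :=
  SLn g /\ forall h, H h -> pi_eq xi (g *m h) (h *m g).

Definition commutator (C : numClosedFieldType) (n : nat) (a b : 'M[C]_n) : 'M[C]_n :=
  a *m b *m invmx a *m invmx b.

Definition commk (C : numClosedFieldType) (n : nat) (xi : C) (a b : 'M[C]_n) : nat :=
  if [pick k : 'I_n | commutator a b == (xi ^+ k)%:M] is Some k then nat_of_ord k else 0%N.

(* phi_H(pi a, pi b) = k/n in Q/Z, represented by its canonical representative in [0,1) *)
Definition phi (C : numClosedFieldType) (n : nat) (xi : C) (a b : 'M[C]_n) : rat :=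
  (commk xi a b)%:R / n%:R.

Definition Z_conjugate (C : numClosedFieldType) (n : nat) (xi : C)
  (H1 H2 : 'M[C]_n -> Prop) : Prop :=
  exists g : 'M[C]_n, SLn g /\
    forall x, Ulift xi H1 x <-> Ulift xi H2 (g *m x *m invmx g).

(* (Z_n(H1), phi_H1) and (Z_n(H2), phi_H2) are isometric: there is a group
   isomorphism Z_n(H1) -> Z_n(H2) preserving the forms; F is a lift of it. *)
Definition alt_isometric (C : numClosedFieldType) (n : nat) (xi : C)
  (H1 H2 : 'M[C]_n -> Prop) : Prop :=
  exists F : 'M[C]_n -> 'M[C]_n,
    [/\ (forall a, Ulift xi H1 a -> Ulift xi H2 (F a)),
        (forall a b, Ulift xi H1 a -> Ulift xi H1 b ->
            (pi_eq xi a b <-> pi_eq xi (F a) (F b))),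
        (forall y, Ulift xi H2 y -> exists2 x, Ulift xi H1 x & pi_eq xi (F x) y),
        (forall a b, Ulift xi H1 a -> Ulift xi H1 b ->
            pi_eq xi (F (a *m b)) (F a *m F b)) &
        (forall a b, Ulift xi H1 a -> Ulift xi H1 b ->
            phi xi (F a) (F b) = phi xi a b)].

(* Main.v *)
(** Write U_i for the lift of the centralizer of H_i.  A non-scalar element of
    U_i is multiplied by a nontrivial root of unity under conjugation by some
    element of H_i (Schur), so it has trace 0; hence inequivalent elements of
    U_i are linearly independent and U_i is finite.  Given a lift F of an
    isometry, the operators X |-> F(a) X a^-1 on n x n matrices commute, and the
    eigenvalues on a common eigenvector rescale F to a genuine representation
    rho of U_1, which has the same trace as the inclusion because both traces
    vanish off the scalars.  Two representations of a finite group with equal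
    traces are equivalent: an intertwiner that is not invertible can be
    completed, on complements of its kernel and image, to one of larger rank.
    An invertible intertwiner, normalized to determinant 1, conjugates U_1 onto
    U_2. *)

Require Import Defs.
From HB Require Import structures.
From mathcomp Require Import all_boot all_order all_algebra.
From Stdlib Require Import Classical.
Set Implicit Arguments. Unset Strict Implicit. Unset Printing Implicit Defensive.
Import Order.TTheory GRing.Theory Num.Theory.
Local Open Scope ring_scope.

(** * Matrix inverses and idempotents *)

Lemma invmx_mul (F : fieldType) (n : nat) (a b : 'M[F]_n) :
  a \in unitmx -> b \in unitmx -> invmx (a *m b) = invmx b *m invmx a.
Proof.
move=> ua ub; have uab : a *m b \in unitmx by rewrite unitmx_mul ua.
apply: (can_inj (mulKmx uab)); rewrite mulmxV // !mulmxA mulmxK //.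
by rewrite mulmxV.
Qed.

(** In a rank factorization P = AB, A has a left inverse and B a right inverse. Cancelling them in
    PP = P gives BA = 1, so the trace of P is its rank, which characteristic 0 detects. *)
Lemma idempotent_trace0 (F : numFieldType) (n : nat) (P : 'M[F]_n) :
  P *m P = P -> \tr P = 0 -> P = 0.
Proof.
move=> PP trP; apply/eqP; rewrite -mxrank_eq0 -(pnatr_eq0 F).
have factor r (A : 'M_(n, r)) (B : 'M_(r, n)) L R' :
    L *m A = 1%:M -> B *m R' = 1%:M -> A *m B = P -> B *m A = 1%:M.
  move=> LA BR AB; transitivity (L *m (P *m P) *m R').
    by rewrite -AB !mulmxA LA mul1mx -!mulmxA BR mulmx1.
  by rewrite PP -AB mulmxA LA mul1mx.
have /row_fullP[L LA] := col_base_full P.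
have /row_freeP[R' BR] := row_base_free P.
have RC := factor _ _ _ _ _ LA BR (mulmx_base P).
by rewrite -mxtrace1 -RC mxtrace_mulC mulmx_base trP.
Qed.

(** * Equal traces give equivalent representations of a finite matrix group *)

Section Averaging.

Variables (F : numFieldType) (n : nat) (S : seq 'M[F]_n).
Implicit Types (r s : 'M[F]_n -> 'M[F]_n) (X T : 'M[F]_n).

Definition group_seq : Prop :=
  [/\ uniq S, 1%:M \in S, {in S, forall a, a \in unitmx},
      {in S &, forall a b, a *m b \in S} & {in S, forall a, invmx a \in S}].

Definition representation r : Prop :=
  r 1%:M = 1%:M /\ {in S &, {morph r : a b / a *m b}}.

(** The unnormalized averaging operator: when [r] and [s] are representations, it sends any matrix
    to an intertwiner from [s] to [r]. *)
Definition reynolds r s X : 'M[F]_n := \sum_(a <- S) r a *m X *m s (invmx a).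

Hypothesis gS : group_seq.

Lemma representation_id : representation id.
Proof. by []. Qed.

Lemma representationV r a : representation r -> a \in S ->
  r a *m r (invmx a) = 1%:M /\ r (invmx a) *m r a = 1%:M.
Proof.
case: gS => _ _ uS _ VS [r1 rM] Sa.
by rewrite -!rM ?VS // mulmxV ?mulVmx ?uS.
Qed.

Lemma perm_translate b : b \in S -> perm_eq S [seq b *m a | a <- S].
Proof.
case: gS => Su _ uS MS VS Sb.
have inj : injective (fun a : 'M[F]_n => b *m a).
  by move=> x y /(congr1 (mulmx (invmx b))); rewrite !mulKmx ?uS.
apply: uniq_perm; rewrite ?map_inj_uniq // => x.
apply/idP/mapP => [Sx | [y Sy ->]]; last exact: MS.
by exists (invmx b *m x); rewrite ?mulKVmx ?uS // MS ?VS.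
Qed.

Lemma reynolds_intertwines r s X b : representation r -> representation s ->
  b \in S -> r b *m reynolds r s X = reynolds r s X *m s b.
Proof.
move=> rr rs Sb; have [_ _ uS MS VS] := gS.
rewrite {2}/reynolds (perm_big _ (perm_translate Sb)) /= big_map.
rewrite mulmx_sumr mulmx_suml; apply: eq_big_seq => a Sa.
rewrite invmx_mul ?uS //.
rewrite rr.2 // rs.2 ?VS // -!mulmxA (representationV rs Sb).2 mulmx1.
by rewrite !mulmxA.
Qed.

(* With X ranging over the matrix units, the left hand side is the trace of
   the operator X |-> \sum_a u a X v a. *)
Lemma trace_sandwich (u v : 'M[F]_n -> 'M[F]_n) :
  \sum_i \sum_j (\sum_(a <- S) u a *m delta_mx i j *m v a) i j
    = \sum_(a <- S) \tr (u a) * \tr (v a).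
Proof.
under eq_bigr => i _ do under eq_bigr => j _ do rewrite summxE.
under eq_bigr => i _ do rewrite exchange_big /=.
rewrite exchange_big /=; apply: eq_bigr => a _.
rewrite /mxtrace mulr_suml; apply: eq_bigr => i _.
rewrite mulr_sumr; apply: eq_bigr => j _.
rewrite -mulmxA mxE (bigD1 i) //= big1 ?addr0 => [|k ki].
  rewrite mxE (bigD1 j) //= big1 ?addr0 => [|k kj]; first by rewrite mxE !eqxx mul1r.
  by rewrite mxE (negPf kj) andbF mul0r.
by rewrite mxE big1 ?mulr0 // => l _; rewrite mxE (negPf ki) mul0r.
Qed.

Lemma mul_lin_sandwich (u v : 'M[F]_n -> 'M[F]_n) X :
  mxvec X *m (\sum_(a <- S) lin_mulmx (u a) *m lin_mulmxr (v a))
    = mxvec (\sum_(a <- S) u a *m X *m v a).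
Proof.
rewrite mulmx_sumr raddf_sum; apply: eq_bigr => a _.
by rewrite mulmxA !mul_vec_lin.
Qed.

(** Rows of the operator matrix are indexed by matrix units, so its diagonal is the double sum
    computed by [trace_sandwich]. *)
Lemma trace_lin_sandwich (u v : 'M[F]_n -> 'M[F]_n) :
  \tr (\sum_(a <- S) lin_mulmx (u a) *m lin_mulmxr (v a) : 'M_(n * n))
    = \sum_(a <- S) \tr (u a) * \tr (v a).
Proof.
set Q := (\sum_(a <- S) _).
rewrite -trace_sandwich /mxtrace pair_big /=.
rewrite (reindex _ (curry_mxvec_bij _ _)) /=; apply: eq_bigr => -[i j] _ /=.
have -> : Q (mxvec_index i j) (mxvec_index i j)
    = row (mxvec_index i j) Q 0 (mxvec_index i j) by rewrite mxE.
by rewrite rowE -mxvec_delta mul_lin_sandwich mxvecE.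
Qed.


Variable rho : 'M[F]_n -> 'M[F]_n.
Hypotheses (rep_rho : representation rho)
  (tr_rho : {in S, forall a, \tr (rho a) = \tr a}).

Definition intertwiner T : Prop := {in S, forall a, rho a *m T = T *m a}.

(* X |-> \sum_a e a X a^-1 e is #|S| times an idempotent fixing e, of trace 0. *)
Lemma commuting_idempotent0 e : e *m e = e ->
  {in S, forall a, a *m e = e *m a} ->
  \sum_(a <- S) \tr (e *m a) * \tr (invmx a *m e) = 0 -> e = 0.
Proof.
case: gS => _ S1 uS _ _ ee ae tr0.
have m0 : (size S)%:R != 0 :> F.
  by rewrite pnatr_eq0; case: (S) S1.
pose Q : 'M_(n * n) := \sum_(a <- S) lin_mulmx (e *m a) *m lin_mulmxr (invmx a *m e).
pose P X := e *m reynolds id id X *m e.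
have QE X : mxvec X *m Q = mxvec (P X).
  rewrite mul_lin_sandwich /P /reynolds mulmx_sumr mulmx_suml; congr mxvec.
  by apply: eq_bigr => a _; rewrite !mulmxA.
(* Every term of the average equals Y once Y commutes with the group. *)
have fixP Y : {in S, forall a, a *m Y = Y *m a} -> e *m Y *m e = Y ->
    P Y = (size S)%:R *: Y.
  move=> cY eY; rewrite /P /reynolds (eq_big_seq (fun=> Y)) => [|a Sa].
    rewrite big_const_seq count_predT iter_addr_0 -scaler_nat.
    by rewrite -scalemxAr -scalemxAl eY.
  by rewrite cY // mulmxK ?uS.
have PP X : P (P X) = (size S)%:R *: P X.
  apply: fixP => [a Sa|].
    rewrite /P !mulmxA (ae _ Sa) -(mulmxA e a).
    rewrite (reynolds_intertwines X representation_id representation_id Sa).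
    by rewrite -!mulmxA (ae _ Sa).
  by rewrite /P !mulmxA ee -!mulmxA ee.
have QQ : Q *m Q = (size S)%:R *: Q.
  apply/row_matrixP => k; rewrite !rowE mulmxA -scalemxAr.
  by rewrite -[delta_mx 0 k]vec_mxK QE QE PP linearZ.
have Q0 : Q = 0.
  suff: (size S)%:R^-1 *: Q = 0 by move/eqP; rewrite scaler_eq0 invr_eq0 (negPf m0) => /eqP.
  apply: idempotent_trace0.
    by rewrite -scalemxAr -scalemxAl QQ (scalerA _ (size S)%:R) mulVf // scale1r.
  by rewrite mxtraceZ trace_lin_sandwich tr0 mulr0.
have := QE e; rewrite Q0 mulmx0 fixP //; last by rewrite ee.
move/esym/(congr1 vec_mx)/eqP.
by rewrite mxvecK linear0 scaler_eq0 (negPf m0) => /eqP.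
Qed.

(** By averaging, T gets an equivariant generalized inverse R', whence idempotents e and f with Te =
    0 and fT = 0. A nonzero intertwiner of the form fXe can be added to T without losing rank. If
    there is none, the corresponding trace sum vanishes; as f and e carry the same character, this
    forces e = 0 and T is invertible. *)
Lemma intertwiner_grow T : intertwiner T -> T \notin unitmx ->
  exists2 T', intertwiner T' & (\rank T < \rank T')%N.
Proof.
move=> iT nuT; have [_ S1 uS MS VS] := gS.
have m0 : (size S)%:R != 0 :> F.
  by rewrite pnatr_eq0; case: (S) S1.
have [p TpT] : exists p, T *m p *m T = T.
  by exists (pinvmx T); rewrite mulmxKpV.
pose R' := (size S)%:R^-1 *: reynolds id rho p.
have iR : {in S, forall a, a *m R' = R' *m rho a}.
  move=> a Sa; rewrite -scalemxAr -scalemxAl.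
  by rewrite (reynolds_intertwines _ representation_id rep_rho Sa).
(* T a p rho(a^-1) T = rho(a) (T p T) a^-1 = T, so averaging keeps the generalized inverse
   property. *)
have TRT : T *m R' *m T = T.
  rewrite -scalemxAr -scalemxAl mulmx_sumr mulmx_suml.
  rewrite (eq_big_seq (fun=> T)) => [|a Sa].
    rewrite big_const_seq count_predT iter_addr_0 -scaler_nat scalerA.
    by rewrite mulVf // scale1r.
  rewrite !mulmxA -(iT _ Sa) -(mulmxA _ (rho _) T) (iT _ (VS _ Sa)) mulmxA.
  rewrite -(mulmxA (rho a) T) -(mulmxA (rho a) (T *m _)) TpT.
  by rewrite (iT _ Sa) mulmxK ?uS.
pose e := 1%:M - R' *m T; pose f := 1%:M - T *m R'.
have Te : T *m e = 0 by rewrite mulmxBr mulmx1 mulmxA TRT subrr.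
have fT : f *m T = 0 by rewrite mulmxBl mul1mx TRT subrr.
have ee : e *m e = e by rewrite {1}/e mulmxBl mul1mx -mulmxA Te mulmx0 subr0.
have ff : f *m f = f by rewrite {2}/f mulmxBr mulmx1 mulmxA fT mul0mx subr0.
have ae : {in S, forall a, a *m e = e *m a}.
  move=> a Sa; rewrite mulmxBr mulmxBl mulmx1 mul1mx mulmxA iR //.
  by rewrite -!mulmxA iT.
have af : {in S, forall a, rho a *m f = f *m rho a}.
  move=> a Sa; rewrite mulmxBr mulmxBl mulmx1 mul1mx mulmxA iT //.
  by rewrite -!mulmxA iR.
(* Both sides subtract the same quantity, tr(T R' rho a) = tr(R' T a), from equal traces. *)
have trf : {in S, forall a, \tr (f *m rho a) = \tr (e *m a)}.
  move=> a Sa; rewrite !mulmxBl !mul1mx !raddfB /= tr_rho // -!mulmxA -iR //.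
  by rewrite mxtrace_mulC -mulmxA mxtrace_mulC -mulmxA (mxtrace_mulC R').
pose D i j := f *m reynolds rho id (delta_mx i j) *m e.
have [/existsP[i /existsP[j D0]]|D0] := boolP [exists i, exists j, D i j != 0].
  exists (T + D i j).
    move=> a Sa; rewrite mulmxDl mulmxDr (iT _ Sa) /D !mulmxA (af _ Sa).
    rewrite -(mulmxA f (rho a)) (reynolds_intertwines _ rep_rho representation_id Sa).
    by rewrite mulmxA -(mulmxA _ a e) (ae _ Sa) mulmxA.
  have DRT : D i j *m R' *m T = 0.
    have eRT : e *m (R' *m T) = 0.
      by rewrite mulmxBl mul1mx -mulmxA (mulmxA T) TRT subrr.
    by rewrite /D -(mulmxA _ R' T) -(mulmxA _ e) eRT mulmx0.
  have fD : f *m D i j = D i j by rewrite /D !mulmxA ff.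
  (* Multiplying on the right by R'T kills D and fixes T. *)
  have kerS : (kermx (T + D i j) <= kermx T)%MS.
    apply/sub_kermxP; have /(congr1 (mulmx^~ (R' *m T))) := mulmx_ker (T + D i j).
    by rewrite mul0mx -mulmxA mulmxDl !mulmxA TRT DRT addr0.
  (* If the rank did not grow, the two left kernels would coincide. The rows of f lie in this
     kernel, so fD = 0, whereas fD = D. *)
  rewrite ltnNge; apply: contra D0 => rk.
  have /sub_kermxP : (kermx T <= kermx (T + D i j))%MS.
    by rewrite -(geq_leqif (mxrank_leqif_sup kerS)) !mxrank_ker leq_sub2l.
  rewrite mulmxDr mulmx_ker add0r => kD.
  have /submxP[Y fE] : (f <= kermx T)%MS by apply/sub_kermxP.
  by rewrite -fD fE -mulmxA kD mulmx0.
have e0 : e = 0.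
  apply: commuting_idempotent0 => //.
  (* Replacing tr(ea) by tr(f rho a) makes the sum the trace of the operator X -> f (sum of rho(a) X
     a^-1) e, whose values on matrix units are the [D i j]. *)
  rewrite -(eq_big_seq _ (fun a Sa => congr1 (fun x => x * _) (trf a Sa))).
  rewrite -trace_sandwich big1 // => i _; rewrite big1 // => j _.
  have : D i j == 0.
    by move: D0; rewrite negb_exists => /forallP/(_ i); rewrite negb_exists => /forallP/(_ j)/negPn.
  rewrite /D /reynolds mulmx_sumr mulmx_suml => /eqP D0ij.
  transitivity ((0 : 'M[F]_n) i j); last by rewrite mxE.
  rewrite -[in RHS]D0ij; congr (fun_of_matrix _ i j).
  by apply: eq_bigr => a _; rewrite !mulmxA.
by move/eqP: e0; rewrite subr_eq0 => /eqP/esym/mulmx1_unit[_ uT]; rewrite uT in nuT.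
Qed.

(** Induction on the corank, starting from the zero intertwiner. *)
Lemma invertible_intertwiner : exists2 T, T \in unitmx & intertwiner T.
Proof.
suff grow k T : intertwiner T -> (n - \rank T <= k)%N ->
    exists2 T', T' \in unitmx & intertwiner T'.
  by apply: (grow n 0); rewrite ?leq_subr // => a _; rewrite mulmx0 mul0mx.
elim: k T => [|k IHk] T iT le.
  exists T => //; rewrite -row_free_unit /row_free eqn_leq rank_leq_row.
  by rewrite -subn_eq0 -leqn0.
have [uT|nuT] := boolP (T \in unitmx); first by exists T.
have [T' iT' lt] := intertwiner_grow iT nuT.
apply: (IHk T') => //; rewrite leq_subLR.
by move: le; rewrite leq_subLR addnS => /leq_trans-> //; rewrite -addSn leq_add2r.
Qed.

End Averaging.

(** * Commutation up to a scalar, and determinant 1 *)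

Lemma scale_commM (F : fieldType) (n : nat) (x y : F) (h a b : 'M[F]_n) :
  a *m h = x *: (h *m a) -> b *m h = y *: (h *m b) ->
  a *m b *m h = (x * y) *: (h *m (a *m b)).
Proof.
move=> ah bh; rewrite -(mulmxA a b h) bh -scalemxAr (mulmxA a h b) ah -scalemxAl scalerA.
by rewrite mulrC mulmxA.
Qed.

Lemma scale_commV (F : fieldType) (n : nat) (x : F) (h a : 'M[F]_n) :
  a \in unitmx -> x != 0 -> a *m h = x *: (h *m a) ->
  invmx a *m h = x^-1 *: (h *m invmx a).
Proof.
move=> ua x0 ah.
transitivity (x^-1 *: (invmx a *m (a *m h) *m invmx a)); last by rewrite mulKmx.
by rewrite ah -scalemxAr -scalemxAl scalerA mulVf // scale1r -!mulmxA mulmxV // mulmx1.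
Qed.

Lemma SLn_unitmx (C : numClosedFieldType) (n : nat) (g : 'M[C]_n) :
  SLn g -> g \in unitmx.
Proof. by move=> dg; rewrite unitmxE dg unitr1. Qed.

Lemma SLnM (C : numClosedFieldType) (n : nat) (a b : 'M[C]_n) :
  SLn a -> SLn b -> SLn (a *m b).
Proof. by rewrite /SLn det_mulmx => -> ->; rewrite mul1r. Qed.

Lemma SLnV (C : numClosedFieldType) (n : nat) (a : 'M[C]_n) :
  SLn a -> SLn (invmx a).
Proof. by rewrite /SLn det_inv => ->; rewrite invr1. Qed.

Lemma SLnJ (C : numClosedFieldType) (n : nat) (g a : 'M[C]_n) :
  SLn g -> SLn (g *m a *m invmx g) <-> SLn a.
Proof. by rewrite /SLn !det_mulmx det_inv => ->; rewrite invr1 mul1r mulr1. Qed.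

(** * Equality modulo powers of [xi] *)

Section Projectivization.

Variables (C : numClosedFieldType) (n : nat) (xi : C).
Hypotheses (hn : (0 < n)%N) (hxi : n.-primitive_root xi).
Implicit Types (a b c : 'M[C]_n) (x y : C).

Lemma pi_eq_refl a : pi_eq xi a a.
Proof. by exists 0%N; rewrite expr0 scale1r. Qed.

Lemma pi_eq_sym a b : pi_eq xi a b -> pi_eq xi b a.
Proof.
(* The exponents add up to kn, and xi^(kn) = 1. *)
case=> k ->; exists (k * n.-1)%N.
rewrite scalerA -exprD addnC -mulnS prednK // mulnC exprM.
by rewrite (prim_expr_order hxi) expr1n scale1r.
Qed.

Lemma pi_eq_trans a b c : pi_eq xi a b -> pi_eq xi b c -> pi_eq xi a c.
Proof. by case=> k -> [l ->]; exists (k + l)%N; rewrite scalerA exprD. Qed.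

Lemma pi_eqM a a' b b' : pi_eq xi a a' -> pi_eq xi b b' ->
  pi_eq xi (a *m b) (a' *m b').
Proof.
case=> k -> [l ->]; exists (k + l)%N.
by rewrite -scalemxAl -scalemxAr scalerA exprD.
Qed.

Lemma pi_eqJ g a b : pi_eq xi a b -> pi_eq xi (g *m a *m invmx g) (g *m b *m invmx g).
Proof. by move=> ab; do 2?[apply: pi_eqM]; rewrite //; apply: pi_eq_refl. Qed.

Lemma prim_root_neq0 : xi != 0.
Proof. by rewrite (prim_root_eq0 hxi) -lt0n. Qed.

Lemma pi_eq_SLn a b : pi_eq xi a b -> SLn b -> SLn a.
Proof.
case=> k ->; rewrite /SLn detZ => ->.
by rewrite mulr1 exprAC (prim_expr_order hxi) expr1n.
Qed.

(** Comparing determinants gives x^n = 1. *)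
Lemma SLn_scale_pi_eq x a : SLn a -> SLn (x *: a) -> pi_eq xi (x *: a) a.
Proof.
rewrite /SLn detZ => ->; rewrite mulr1 => /(prim_rootP hxi)[k ->].
by exists k.
Qed.

End Projectivization.

(** * The lifted centralizer: Schur's lemma, traces, commutators, finiteness *)

Section Centralizer.

Variables (C : numClosedFieldType) (n : nat) (xi : C).
Hypotheses (hn : (0 < n)%N) (hxi : n.-primitive_root xi).
Variable H : 'M[C]_n -> Prop.
Hypotheses (sH : subgroup_SL H) (iH : irreducible_SL H).
Implicit Types (a b c : 'M[C]_n) (x y : C).

(** An eigenspace of a^T is stable under every h^T, the row form in which irreducibility is stated,
    and it is nonzero, hence everything. *)
Lemma irreducible_schur a : (forall h, H h -> a *m h = h *m a) ->
  exists x, a = x%:M.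
Proof.
move=> ah; have [x ev] := eigenvalue_closed a^T hn; exists x.
have Ua : eigenspace a^T x *m a^T = x *: eigenspace a^T x by apply/eigenspaceP.
have /iH[U0|Un] h : H h -> (eigenspace a^T x *m h^T <= eigenspace a^T x)%MS.
- move=> Hh; apply/eigenspaceP.
  by rewrite -mulmxA -trmx_mul ah // trmx_mul mulmxA Ua scalemxAl.
- by move: ev; rewrite /eigenvalue -mxrank_eq0 U0.
have uU : eigenspace a^T x \in unitmx by rewrite -row_free_unit /row_free Un.
apply: trmx_inj; rewrite tr_scalar_mx; apply: (can_inj (mulKmx uU)).
by rewrite Ua mul_mx_scalar.
Qed.

Lemma Ulift_SLn a : Ulift xi H a -> SLn a.
Proof. by case. Qed.

Lemma Ulift_unitmx a : Ulift xi H a -> a \in unitmx.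
Proof. by move/Ulift_SLn/SLn_unitmx. Qed.

Lemma subgroup_unitmx h : H h -> h \in unitmx.
Proof. by case: sH => _ _ _ dH /dH/SLn_unitmx. Qed.

Lemma Ulift1 : Ulift xi H 1%:M.
Proof.
split=> [|h _]; first exact: det1.
by rewrite mulmx1 mul1mx; apply: pi_eq_refl.
Qed.

Lemma UliftM a b : Ulift xi H a -> Ulift xi H b -> Ulift xi H (a *m b).
Proof.
move=> [da ca] [db cb]; split=> [|h Hh]; first exact: SLnM.
apply: (@pi_eq_trans _ _ _ _ (a *m h *m b)).
  by rewrite -!mulmxA; apply: pi_eqM (pi_eq_refl _ _) (cb _ Hh).
by rewrite mulmxA; apply: pi_eqM (ca _ Hh) (pi_eq_refl _ _).
Qed.

Lemma UliftV a : Ulift xi H a -> Ulift xi H (invmx a).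
Proof.
move=> Ua; have ua := Ulift_unitmx Ua; case: Ua => da ca.
split=> [|h Hh]; first exact: SLnV.
have -> : invmx a *m h = invmx a *m (h *m a) *m invmx a by rewrite !mulmxA mulmxK.
have -> : h *m invmx a = invmx a *m (a *m h) *m invmx a by rewrite !mulmxA mulVmx ?mul1mx.
apply: pi_eqM (pi_eq_refl _ _); apply: pi_eqM; first exact: pi_eq_refl.
exact: (pi_eq_sym hn hxi (ca _ Hh)).
Qed.

Lemma Ulift_pi_eq a b : pi_eq xi b a -> Ulift xi H a -> Ulift xi H b.
Proof.
move=> ba [da ca]; split=> [|h Hh]; first exact: (pi_eq_SLn hxi ba).
apply: pi_eq_trans (pi_eqM ba (pi_eq_refl _ _)) _.
apply: pi_eq_trans (ca _ Hh) _.
exact: pi_eqM (pi_eq_refl _ _) (pi_eq_sym hn hxi ba).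
Qed.

Lemma Ulift_trace a : Ulift xi H a -> pi_eq xi a 1%:M \/ \tr a = 0.
Proof.
move=> Ua; have [da ca] := Ua.
have [cen|ncen] := classic (forall h, H h -> a *m h = h *m a).
  left; have [x ax] := irreducible_schur cen.
  move: da; rewrite ax -[x%:M]scalemx1 => dx; apply: (SLn_scale_pi_eq hxi _ dx).
  by rewrite /SLn det1.
right; have [h] := not_all_ex_not _ _ ncen.
move=> nh; have [Hh ah] : H h /\ a *m h <> h *m a by apply: imply_to_and.
have uh := subgroup_unitmx Hh; have [k ek] := ca _ Hh.
have : \tr a = xi ^+ k * \tr a.
  (* With ah = xi^k ha, one has tr a = tr(a h h^-1) = xi^k tr(h a h^-1) = xi^k tr a. *)
  rewrite -[in LHS](mulmxK uh a) ek -scalemxAl mxtraceZ mxtrace_mulC.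
  by rewrite mulmxA mulVmx // mul1mx.
move/eqP; rewrite -{1}[\tr a]mul1r -subr_eq0 -mulrBl mulf_eq0 subr_eq0.
case/orP=> /eqP // k1; case: ah.
by rewrite ek -k1 scale1r.
Qed.

(** Moving h past the commutator produces scalars that cancel, so Schur makes the commutator scalar;
    determinant 1 makes it a power of [xi]. The default value in [commk] is thus never taken
    here. *)
Lemma commutator_Ulift a b : Ulift xi H a -> Ulift xi H b ->
  commutator a b = (xi ^+ commk xi a b)%:M.
Proof.
move=> Ua Ub; have [ua ub] := (Ulift_unitmx Ua, Ulift_unitmx Ub).
have [x cx] : exists x, commutator a b = x%:M.
  apply: irreducible_schur => h Hh.
  have [k ak] := Ua.2 _ Hh; have [l bl] := Ub.2 _ Hh.
  have nz m : xi ^+ m != 0 by rewrite expf_neq0 // (prim_root_neq0 hn hxi).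
  rewrite /commutator (scale_commM (scale_commM (scale_commM ak bl)
    (scale_commV ua (nz k) ak)) (scale_commV ub (nz l) bl)).
  by rewrite mulrAC mulfK ?nz // divff ?nz // scale1r.
rewrite cx /commk; case: pickP => [k /eqP <- //|none].
have : SLn (commutator a b).
  have [da db] := (Ulift_SLn Ua, Ulift_SLn Ub).
  exact: SLnM (SLnM (SLnM da db) (SLnV da)) (SLnV db).
rewrite cx -[x%:M]scalemx1 /SLn detZ det1 mulr1 => /(prim_rootP hxi)[k xk].
by have := none k; rewrite cx xk eqxx.
Qed.

(* Inequivalent elements of the lift are linearly independent, because the
   trace separates them from each other. *)
Lemma Ulift_inequiv_bound (k : nat) (s : 'I_k -> 'M[C]_n) :
  (forall i, Ulift xi H (s i)) -> (forall i j, pi_eq xi (s i) (s j) -> i = j) ->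
  (k <= n * n)%N.
Proof.
move=> Us sinj; pose M := \matrix_i mxvec (s i).
suff /eqP <- : row_free M by apply: rank_leq_col.
apply: inj_row_free => v; rewrite mulmx_sum_row => v0.
have {}v0 : \sum_i v 0 i *: s i = 0.
  apply: (can_inj mxvecK); rewrite linear0 -v0 linear_sum.
  by apply: eq_bigr => i _; rewrite linearZ rowK.
apply/rowP => j; rewrite mxE.
have uj := Ulift_unitmx (Us j).
(* Multiplying the relation by the inverse of [s j] and taking traces leaves only n times the j-th
   coefficient. *)
have := congr1 (fun X => \tr (X *m invmx (s j))) v0.
rewrite mul0mx linear0 mulmx_suml raddf_sum (bigD1 j) //= big1 => [|i ij].
  rewrite addr0 -scalemxAl mulmxV // mxtraceZ mxtrace1 => /eqP.
  by rewrite mulf_eq0 pnatr_eq0 -[n == 0%N]negbK -lt0n hn orbF => /eqP.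
have [eq1|tr0] := Ulift_trace (UliftM (Us i) (UliftV (Us j))).
  case/eqP: ij; apply: sinj.
  have := pi_eqM eq1 (pi_eq_refl xi (s j)).
  by rewrite mulmxKV // mul1mx.
by rewrite -scalemxAl mxtraceZ tr0 mulr0.
Qed.

Lemma Ulift_transversal : exists2 s : seq 'M[C]_n,
  {in s, forall a, Ulift xi H a} &
  forall a, Ulift xi H a -> exists2 b, b \in s & pi_eq xi a b.
Proof.
pose inequiv (s : seq 'M[C]_n) := forall i j, (i < size s)%N -> (j < size s)%N ->
  pi_eq xi (nth 0 s i) (nth 0 s j) -> i = j.
have bound s : inequiv s -> {in s, forall a, Ulift xi H a} -> (size s <= n * n)%N.
  move=> si Us; apply: (@Ulift_inequiv_bound _ (fun i : 'I_(size s) => nth 0 s i)).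
    by move=> i; apply/Us/mem_nth.
  by move=> i j /si ij; apply/val_inj/ij.
(* Greedy extension of an inequivalent list: m is fuel, and at m = 0 the list would exceed the
   bound. *)
suff grow m s : inequiv s -> {in s, forall a, Ulift xi H a} ->
    (n * n < size s + m)%N -> exists2 s : seq 'M[C]_n,
    {in s, forall a, Ulift xi H a} &
    forall a, Ulift xi H a -> exists2 b, b \in s & pi_eq xi a b.
  by apply: (grow (n * n).+1 [::]).
elim: m s => [|m IHm] s si Us lt; first by have := bound s si Us; rewrite leqNgt -[size s]addn0 lt.
have [cover|] := classic (forall a, Ulift xi H a -> exists2 b, b \in s & pi_eq xi a b).
  by exists s.
move=> ncover; have [a na'] := not_all_ex_not _ _ ncover.
have [Ua na] := imply_to_and _ _ na'.
apply: (IHm (a :: s)); last by rewrite addSnnS.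
  case=> [|i] [|j] //= lti ltj eij; last by rewrite (si i j).
    by case: na; exists (nth 0 s j); rewrite ?mem_nth.
  case: na; exists (nth 0 s i); rewrite ?mem_nth //.
  exact: (pi_eq_sym hn hxi).
by move=> b; rewrite inE => /orP[/eqP->|/Us].
Qed.

Lemma Ulift_finite : exists2 S : seq 'M[C]_n, group_seq S &
  forall a, a \in S <-> Ulift xi H a.
Proof.
have [s Us cover] := Ulift_transversal.
pose S := undup [seq xi ^+ k *: a | a <- s, k <- iota 0 n].
have SP a : a \in S <-> Ulift xi H a.
  rewrite mem_undup; split=> [/allpairsP[[b k] /= [sb _ ->]] | Ua].
    by apply: Ulift_pi_eq (Us _ sb); exists k.
  have [b sb [k ->]] := cover _ Ua; rewrite -(prim_expr_mod hxi).
  by apply/allpairsP; exists (b, (k %% n)%N); rewrite mem_iota ltn_mod.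
exists S => //; split; first exact: undup_uniq.
- exact/SP/Ulift1.
- by move=> a /SP/Ulift_unitmx.
- by move=> a b /SP Ua /SP Ub; apply/SP/UliftM.
- by move=> a /SP Ua; apply/SP/UliftV.
Qed.

End Centralizer.

(** This upgrades equality up to a scalar to equality, by testing on one nonzero matrix X. *)
Lemma scale_agree (F : fieldType) (n : nat) (y : F) (A B X : 'M[F]_n) :
  A = y *: B -> B \in unitmx -> X != 0 -> A *m X = B *m X -> A = B.
Proof.
move=> -> uB X0; rewrite -scalemxAl => /(congr1 (mulmx (invmx B))).
rewrite -scalemxAr mulKmx // => /eqP.
rewrite -{2}[X]scale1r -subr_eq0 -scalerBl scaler_eq0 (negPf X0) orbF subr_eq0.
by move=> /eqP->; rewrite scale1r.
Qed.

Lemma commutator_conj (C : numClosedFieldType) (n : nat) (g a b : 'M[C]_n) :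
  g \in unitmx -> a \in unitmx -> b \in unitmx ->
  commutator (g *m a *m invmx g) (g *m b *m invmx g)
    = g *m commutator a b *m invmx g.
Proof.
move=> ug ua ub; rewrite /commutator.
have conjV x : x \in unitmx -> invmx (g *m x *m invmx g) = g *m invmx x *m invmx g.
  by move=> ux; rewrite !invmx_mul ?invmxK ?unitmx_mul ?unitmx_inv ?ug // mulmxA.
by rewrite !conjV // !mulmxA !mulmxKV.
Qed.

(** * Conjugate centralizers and isometric alternate modules *)

Section Isometry.

Variables (C : numClosedFieldType) (n : nat) (xi : C).
Hypotheses (hn : (0 < n)%N) (hxi : n.-primitive_root xi).
Variables H1 H2 : 'M[C]_n -> Prop.
Hypotheses (sH1 : subgroup_SL H1) (sH2 : subgroup_SL H2).
Hypotheses (iH1 : irreducible_SL H1) (iH2 : irreducible_SL H2).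

Lemma conjugate_isometric : Z_conjugate xi H1 H2 -> alt_isometric xi H1 H2.
Proof.
case=> g [dg gU]; have ug := SLn_unitmx dg.
exists (fun x => g *m x *m invmx g); split.
- by move=> a /gU.
- move=> a b Ua Ub; split=> [|ab]; first exact: pi_eqJ.
  have := pi_eqM (pi_eqM (pi_eq_refl xi (invmx g)) ab) (pi_eq_refl xi g).
  by rewrite -!mulmxA mulVmx // !mulmx1 !mulKmx.
- move=> y Uy; have gy : g *m (invmx g *m y *m g) *m invmx g = y.
    by rewrite !mulmxA mulmxK // mulmxV // mul1mx.
  by exists (invmx g *m y *m g); [apply/gU; rewrite gy | rewrite gy; apply: pi_eq_refl].
- by move=> a b _ _; rewrite !mulmxA mulmxKV //; apply: pi_eq_refl.
move=> a b Ua Ub; rewrite /phi /commk commutator_conj ?(Ulift_unitmx Ua) ?(Ulift_unitmx Ub) //.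
(* The commutator is scalar, so conjugation by g fixes it. *)
rewrite (commutator_Ulift hn hxi iH1 Ua Ub).
by rewrite mul_mx_scalar -scalemxAl mulmxV // scalemx1.
Qed.

Variable F : 'M[C]_n -> 'M[C]_n.
Hypotheses (FU : forall a, Ulift xi H1 a -> Ulift xi H2 (F a))
  (Finj : forall a b, Ulift xi H1 a -> Ulift xi H1 b ->
     (pi_eq xi a b <-> pi_eq xi (F a) (F b)))
  (FM : forall a b, Ulift xi H1 a -> Ulift xi H1 b ->
     pi_eq xi (F (a *m b)) (F a *m F b))
  (Fphi : forall a b, Ulift xi H1 a -> Ulift xi H1 b ->
     phi xi (F a) (F b) = phi xi a b).

(** Equal forms give equal exponents [commk], so a single scalar governs both commutation
    relations. *)
Lemma isometry_swap a b : Ulift xi H1 a -> Ulift xi H1 b ->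
  exists x, [/\ x != 0, a *m b = x *: (b *m a) & F a *m F b = x *: (F b *m F a)].
Proof.
move=> Ua Ub; exists (xi ^+ commk xi a b).
have swap (H : 'M[C]_n -> Prop) c d : Ulift xi H c -> Ulift xi H d -> commutator c d = (xi ^+ commk xi a b)%:M ->
    c *m d = xi ^+ commk xi a b *: (d *m c).
  move=> Uc Ud cd; rewrite scalemxAl -mul_scalar_mx -cd /commutator.
  by rewrite !mulmxKV ?(Ulift_unitmx Uc) ?(Ulift_unitmx Ud).
split; first by rewrite expf_neq0 // (prim_root_neq0 hn hxi).
  exact: (swap H1 _ _ Ua Ub (commutator_Ulift hn hxi iH1 Ua Ub)).
apply: (swap H2 _ _ (FU Ua) (FU Ub)).
rewrite (commutator_Ulift hn hxi iH2 (FU Ua) (FU Ub)); congr ((xi ^+ _)%:M).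
have := Fphi Ua Ub; rewrite /phi => /mulIf/eqP.
by rewrite invr_eq0 pnatr_eq0 -lt0n hn eqr_nat => /(_ isT)/eqP.
Qed.

Lemma isometry1 : pi_eq xi (F 1%:M) 1%:M.
Proof.
have U1 := Ulift1 xi H1; have u1 := Ulift_unitmx (FU U1).
apply: (pi_eq_sym hn hxi).
have := pi_eqM (FM U1 U1) (pi_eq_refl xi (invmx (F 1%:M))).
by rewrite mulmx1 mulmxK // mulmxV.
Qed.

(* The operators X |-> F a X a^-1 on matrices commute, since F preserves the
   commutator form; a common eigenvector X gives the eigenvalues by which F has
   to be rescaled. *)
Lemma isometry_eigenvector : exists2 X : 'M[C]_n, X != 0 &
  exists lam : 'M[C]_n -> C, forall a, Ulift xi H1 a ->
    lam a != 0 /\ F a *m X = lam a *: (X *m a).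
Proof.
have [S gS SP] := Ulift_finite hn hxi sH1 iH1.
have [L LE] : exists L : 'M[C]_n -> 'M[C]_(n * n),
    forall a X, mxvec X *m L a = mxvec (F a *m X *m invmx a).
  exists (fun a => lin_mulmx (F a) *m lin_mulmxr (invmx a)) => a X.
  by rewrite mulmxA !mul_vec_lin.
have [||v v0 /allP vS] := @common_eigenvector _ _ [seq L a | a <- S].
- by rewrite muln_gt0 hn.
- move=> _ _ /mapP[a /SP Ua ->] /mapP[b /SP Ub ->].
  have [ua ub] := (Ulift_unitmx Ua, Ulift_unitmx Ub).
  apply/row_matrixP => k; rewrite !rowE !mulmxA -[delta_mx 0 k]vec_mxK !LE.
  (* The scalar x from swapping F a and F b cancels the one from swapping a and b inside the
     inverse. *)
  congr mxvec; have [x [x0 ab Fab]] := isometry_swap Ua Ub.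
  have uba : b *m a \in unitmx by rewrite unitmx_mul ub.
  rewrite !mulmxA -!(mulmxA _ (invmx _)) -!invmx_mul // Fab ab.
  rewrite invmxZ ?unitmxZ ?unitfE // -!scalemxAl -!scalemxAr scalerA.
  by rewrite divff // scale1r.
have [X vX] : exists X : 'M[C]_n, v = mxvec X by exists (vec_mx v); rewrite vec_mxK.
have X0 : X != 0 by apply: contraNneq v0 => X0; rewrite vX X0 linear0.
exists X => //.
have /existsP[i /existsP[j Xij]] : [exists i, exists j, X i j != 0].
  apply: contraNT X0 => /existsPn X0; apply/eqP/matrixP => i j; rewrite mxE.
  by have /existsPn/(_ j)/negPn/eqP := X0 i.
(* The eigenvalue is read off at an entry where X is nonzero. *)
exists (fun a => (F a *m X *m invmx a) i j / X i j) => a Ua.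
have [ua uFa] := (Ulift_unitmx Ua, Ulift_unitmx (FU Ua)).
have /sub_rVP[x] : stablemx v (L a) by apply/vS/map_f/SP.
rewrite vX LE -linearZ => /(can_inj mxvecK) ax.
rewrite ax mxE mulfK //; split; last first.
  by rewrite scalemxAl -ax mulmxKV.
apply: contraNneq X0 => x0; move: ax; rewrite x0 scale0r => ax.
by rewrite -(mulKmx uFa X) -(mulmxKV ua (F a *m X)) ax mul0mx mulmx0.
Qed.

Lemma isometry_conjugator : exists2 g : 'M[C]_n, SLn g &
  forall a, Ulift xi H1 a -> exists x, g *m a *m invmx g = x *: F a.
Proof.
have [X X0 [lam lamP]] := isometry_eigenvector.
have [S gS SP] := Ulift_finite hn hxi sH1 iH1.
(* Rescaled so that rho(a) X = X a, an exact identity to which [scale_agree] applies. *)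
pose rho a := (lam a)^-1 *: F a.
have lam0 a : Ulift xi H1 a -> lam a != 0 by case/lamP.
have rhoX a : Ulift xi H1 a -> rho a *m X = X *m a.
  by move=> /lamP[l0 FaX]; rewrite -scalemxAl FaX scalerA mulVf // scale1r.
have rhoU a : Ulift xi H1 a -> rho a \in unitmx.
  move=> Ua; rewrite unitmxZ ?unitfE ?invr_eq0 ?lam0 //.
  exact: (Ulift_unitmx (FU Ua)).
have rho_id a : Ulift xi H1 a -> pi_eq xi a 1%:M -> rho a = a.
  move=> Ua a1; have Fa1 := pi_eq_trans ((Finj Ua (Ulift1 _ _)).1 a1) isometry1.
  case: Fa1 => k Fa; case: a1 => l al.
  apply: (@scale_agree _ _ ((lam a)^-1 * xi ^+ k * (xi ^+ l)^-1) _ _ X) => //.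
  - have oneE : 1%:M = (xi ^+ l)^-1 *: a.
      by rewrite al scalerA mulVf ?scale1r // expf_neq0 ?(prim_root_neq0 hn hxi).
    by rewrite /rho Fa oneE !scalerA.
  - exact: Ulift_unitmx Ua.
  - by rewrite rhoX // al -scalemxAl -scalemxAr mul1mx mulmx1.
have rep : representation S rho.
  split=> [|a b /SP Ua /SP Ub].
    by rewrite rho_id //; [apply: Ulift1 | apply: pi_eq_refl].
  (* rho(ab) and rho(a) rho(b) are proportional and both send X to X a b. *)
  have [k FMab] := FM Ua Ub.
  apply: (@scale_agree _ _ ((lam (a *m b))^-1 * xi ^+ k * lam b * lam a) _ _ X) => //.
  - rewrite /rho FMab -scalemxAl -scalemxAr !scalerA.
    by rewrite -!mulrA !(mulVKf, mulfV, mulr1) ?lam0.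
  - by rewrite unitmx_mul !rhoU.
  - by rewrite -mulmxA (rhoX b) // mulmxA !rhoX ?mulmxA //; apply: UliftM.
have tr : {in S, forall a, \tr (rho a) = \tr a}.
  move=> a /SP Ua.
  have [a1|ta] := Ulift_trace hn hxi sH1 iH1 Ua; first by rewrite rho_id.
  have [F1|tF] := Ulift_trace hn hxi sH2 iH2 (FU Ua).
    rewrite rho_id //; apply/(Finj Ua (Ulift1 _ _)).
    exact: pi_eq_trans F1 (pi_eq_sym hn hxi isometry1).
  by rewrite mxtraceZ tF mulr0.
have [T uT iT] := invertible_intertwiner gS rep tr.
have dT : \det T != 0 by rewrite -unitfE -unitmxE.
(* Since det(cT) = c^n det T, this choice gives determinant 1. *)
pose c := n.-root (\det T)^-1.
have cn : c ^+ n = (\det T)^-1 by rewrite /c rootCK.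
have dg : SLn (c *: T) by rewrite /SLn detZ cn mulVf.
exists (c *: T) => // a Ua; exists (lam a)^-1.
rewrite -scalemxAl -(iT a) ?scalemxAr; last exact/SP.
by rewrite mulmxK // SLn_unitmx.
Qed.

Lemma isometric_conjugate :
  (forall y, Ulift xi H2 y -> exists2 x, Ulift xi H1 x & pi_eq xi (F x) y) ->
  Z_conjugate xi H1 H2.
Proof.
move=> Fsurj; have [g dg gF] := isometry_conjugator.
have ug := SLn_unitmx dg; exists g; split=> // a.
have gFpi b : Ulift xi H1 b -> pi_eq xi (g *m b *m invmx g) (F b).
  move=> Ub; have [x gx] := gF _ Ub; rewrite gx.
  apply: (SLn_scale_pi_eq hxi (Ulift_SLn (FU Ub))); rewrite -gx.
  exact/(SLnJ _ dg)/(Ulift_SLn Ub).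
split=> [Ua | Uga]; first exact: (Ulift_pi_eq hn hxi (gFpi _ Ua) (FU Ua)).
(* Surjectivity supplies b with g b g^-1 and g a g^-1 equal modulo [xi]; conjugating back, a is
   equivalent to b. *)
have [b Ub Fb] := Fsurj _ Uga; apply: (Ulift_pi_eq hn hxi _ Ub).
have := pi_eq_sym hn hxi (pi_eq_trans (gFpi _ Ub) Fb).
move/(pi_eqM (pi_eq_refl xi (invmx g)))/pi_eqM/(_ (pi_eq_refl xi g)).
by rewrite -!mulmxA mulVmx // !mulmx1 !mulKmx.
Qed.

End Isometry.

Theorem mainTheorem9 (C : numClosedFieldType) (n : nat) (xi : C)
  (hn : (0 < n)%N) (hxi : n.-primitive_root xi)
  (H1 H2 : 'M[C]_n -> Prop)
  (sH1 : subgroup_SL H1) (sH2 : subgroup_SL H2)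
  (pH1 : pi_saturated xi H1) (pH2 : pi_saturated xi H2)
  (iH1 : irreducible_SL H1) (iH2 : irreducible_SL H2) :
  Z_conjugate xi H1 H2 <-> alt_isometric xi H1 H2.
Proof.
split; first exact: conjugate_isometric.
case=> F [FU Finj Fsurj FM Fphi].
exact: (isometric_conjugate hn hxi sH1 sH2 iH1 iH2 FU Finj FM Fphi Fsurj).
Qed.
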